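(* The following hold. (i) For every positive integer $n$ and every positive integer $k$, if $q\geq 6n^{2^k/(2^k-1)}$ then $\mathcal{C}(n,q)<3^k$. (ii) For every $\epsilon>0$ there is $n_0$ such that for all $n\ge n_0$: if $q\geq 1.6n$ then $\mathcal{C}(n,q)< (\ln n)^{\log_2 3+\epsilon}$. (iii) For every $0<\epsilon<1$ there is $n_0$ such that for all $n\ge n_0$: if $q\leq(1-\epsilon)\dfrac{n}{2}$ then $\mathcal{C}(n,q)\geq e^{-\frac{5}{2\epsilon}+\frac32}\, n$. Here $q$ always denotes a positive integer.
   Context: Client-Waiter game on a board $X$ with bias $q$ (a positive integer): two players, Client and Waiter, play in turns. In each turn Waiter offers Client a set of at least $1$ and at most $q+1$ unclaimed elements of $X$; Client claims exactly one of the offered elements and Waiter claims all the other offered elements. The game ends when all elements of $X$ have been claimed. When $X=E(G)$ for a graph $G$, Client's graph is the graph on $V(G)$ whose edges are the edges claimed by Client. $\mathcal{C}(n,q)$ denotes the largest integer $s$ such that, in the Client-Waiter game with bias $q$ on $E(K_n)$, Client has a strategy guaranteeing (against any play of Waiter) that at the end of the game his graph has a connected component of size (number of vertices) at least $s$. *)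

(* Defs.v *)
From mathcomp Require Import all_boot.
From mathcomp Require Import boolp.
Set Implicit Arguments.
Unset Strict Implicit.
Unset Printing Implicit Defensive.

Section Game.
Variable T : finType.
Implicit Types (X A : {set T}) (q : nat).

(* A round (A, x): Waiter offers the set A and Client claims x, so that Waiter
   claims A :\ x. A history lists the rounds played so far, oldest first. *)
Definition history := seq ({set T} * T).

Definition unclaimed X (h : history) : {set T} :=
  X :\: \bigcup_(r <- h) r.1.

Definition client_claimed (h : history) : {set T} :=
  [set x in [seq r.2 | r <- h]].

Definition strategy := history -> {set T} -> T.

Definition valid_strategy (sigma : strategy) : Prop :=
  forall h A, A != set0 -> sigma h A \in A.

(* The histories that can arise, under arbitrary play of Waiter, in the game on
   the board X with bias q when Client follows sigma. *)
Inductive play_against X q (sigma : strategy) : history -> Prop :=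
| play_start : play_against X q sigma [::]
| play_round h A :
    play_against X q sigma h ->
    A \subset unclaimed X h ->
    1 <= #|A| <= q.+1 ->
    play_against X q sigma (rcons h (A, sigma h A)).

Definition client_can_guarantee X q (goal : {set T} -> Prop) : Prop :=
  exists2 sigma : strategy, valid_strategy sigma &
    forall h, play_against X q sigma h -> unclaimed X h = set0 ->
      goal (client_claimed h).

End Game.

Section Components.
Variable n : nat.
Implicit Types (E : {set {set 'I_n}}).

Definition Kn_edges : {set {set 'I_n}} := [set e : {set 'I_n} | #|e| == 2].

Definition adj E : rel 'I_n := fun u v => (u != v) && ([set u; v] \in E).

Definition component E (v : 'I_n) : {set 'I_n} := [set u | connect (adj E) v u].

Definition has_component_geq (s : nat) E : Prop :=
  exists v : 'I_n, s <= #|component E v|.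

End Components.

Definition can_force_component (n q s : nat) : Prop :=
  client_can_guarantee (Kn_edges n) q (has_component_geq s).

(* Restricting to s <= n loses nothing, see CWcomp_max. *)
Definition CWcomp (n q : nat) : nat :=
  \max_(s < n.+1 | `[< can_force_component n q s >]) s.

Section Sanity.
Variable T : finType.
Implicit Types (X A : {set T}).

Lemma complete_play_exists X q (sigma : strategy T) :
  exists2 h, play_against X q sigma h & unclaimed X h = set0.
Proof.
suff H m : forall h, play_against X q sigma h -> #|unclaimed X h| <= m ->
    exists2 h, play_against X q sigma h & unclaimed X h = set0.
  exact: (H _ [::] (play_start _ _ _) (leqnn _)).
elim: m => [|m IH] h ph.
  by rewrite leqn0 cards_eq0 => /eqP h0; exists h.
move=> hm; have [h0|[x xh]] := set_0Vmem (unclaimed X h); first by exists h.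
apply: (IH (rcons h ([set x], sigma h [set x]))).
  by apply: play_round; rewrite ?sub1set ?cards1.
rewrite -ltnS; apply: leq_trans hm; apply: proper_card.
rewrite /unclaimed -cats1 big_cat /= big_seq1 /=.
apply/properP; split; first by rewrite setDS // subsetUl.
by exists x => //; rewrite !inE eqxx orbT.
Qed.

End Sanity.

Lemma CWcomp_max (n q : nat) : 0 < n ->
  can_force_component n q (CWcomp n q) /\
  (forall s, can_force_component n q s -> s <= CWcomp n q).
Proof.
move=> n0; have bnd s : can_force_component n q s -> s < n.+1.
  case=> sigma _ H.
  have [h ph h0] := complete_play_exists (Kn_edges n) q sigma.
  have [v sv] := H h ph h0.
  by rewrite ltnS (leq_trans sv) // -[leqRHS]card_ord max_card.
have P0 : can_force_component n q 0.
  exists (fun _ (A : {set {set 'I_n}}) => odflt set0 [pick x in A]).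
    by move=> _ A /set0Pn[x xA]; case: pickP => [//|/(_ x)]; rewrite xA.
  by move=> h _ _; exists (Ordinal n0).
split.
  have [|i /asboolP Pi e] := @eq_bigmax_cond 'I_n.+1
      [pred s : 'I_n.+1 | `[< can_force_component n q s >]] (fun s => s : nat).
    by apply/card_gt0P; exists ord0; apply/asboolP.
  by rewrite /CWcomp e.
move=> s Ps; have sn := bnd s Ps.
by apply: (@leq_bigmax_cond _ _ (fun i : 'I_n.+1 => i : nat) (Ordinal sn)); apply/asboolP.
Qed.

(* Main.v *)
Require Import Defs.
From mathcomp Require Import all_classical all_reals all_analysis.
From mathcomp Require Import all_boot all_order all_algebra.
From mathcomp Require Import zify ring lra.
Set Implicit Arguments.
Unset Strict Implicit.
Unset Printing Implicit Defensive.
Import Order.TTheory GRing.Theory Num.Theory.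

(** Upper bounds. Waiter plays in phases, regarding the vertices as classes that
contain the components of Client's graph. A phase starts with [N] classes of
size at most [c], any two joined by at most [e] free edges, all other pairs of
classes being exhausted. As long as [u] untouched classes remain, Waiter offers
all edges from a set of about [q / (e * u)] of them to all untouched ones. Client
thereby creates one pair, and the rest of the set has no edge left except towards
the pairs. When no untouched class remains she offers, for each pair, its edges to
these leftover classes, so each pair becomes a triple. The new phase starts with as
many triples as there were rounds, with [e] and [c] multiplied by three. The
number of rounds is at most [2 * e * N ^ 2 / q], so [6 * e * N / q] gets squared.
When [q >= 1.6 * n] this ratio is not yet below one, but counting at least two
classes per round shows that [e * N] still decreases by a constant factor, and
after boundedly many phases squaring takes over.

Lower bound. Client claims an edge joining two components whenever he can. He does so
at most [n - 1] times, so at most [(q + 1) * (n - 1)] edges join distinct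
components of his final graph, while components of size below [s] would leave
more than [n * (n - s) / 2] such edges. *)

(** * The game seen by Waiter, up to merging of label classes *)

Lemma unclaimed_rcons (T : finType) (X : {set T}) h A x :
  unclaimed X (rcons h (A, x)) = unclaimed X h :\: A.
Proof. by rewrite /unclaimed -cats1 big_cat /= big_seq1 /= setDDl. Qed.

Lemma client_claimed_rcons (T : finType) (h : history T) A x :
  client_claimed (rcons h (A, x)) = x |: client_claimed h.
Proof. by apply/setP => y; rewrite !inE map_rcons mem_rcons inE. Qed.

Section WaiterGame.
Variables (n q s : nat).
Implicit Types (E F A : {set {set 'I_n}}) (f g : 'I_n -> 'I_n).
Implicit Types (w : 'I_n -> 'I_n -> nat) (z : 'I_n -> nat).

Definition coarser f g := forall u v, f u = f v -> g u = g v.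

Definition monochromatic f (x : {set 'I_n}) := {in x &, forall u v, f u = f v}.

(* Only a labelling that is constant on the components of Client's graph is
   remembered; Waiter may merge labels at will, which only hurts her. *)
Inductive waiter_wins : {set {set 'I_n}} -> ('I_n -> 'I_n) -> Prop :=
| wins_end f : (forall k, #|[set u | f u == k]| < s) -> waiter_wins set0 f
| wins_coarsen E f g : coarser f g -> waiter_wins E g -> waiter_wins E f
| wins_round E f A (g : {set 'I_n} -> 'I_n -> 'I_n) :
    A \subset E -> 0 < #|A| <= q.+1 ->
    (forall x, x \in A -> coarser f (g x)) ->
    (forall x, x \in A -> monochromatic (g x) x) ->
    (forall x, x \in A -> waiter_wins (E :\: A) (g x)) -> waiter_wins E f.

(** Waiter offers the edges one at a time; each lies inside a class, so the labelling never has to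
    change. *)
Lemma wins_monochromatic E f :
  {in E, forall x, monochromatic f x} ->
  (forall k, #|[set u | f u == k]| < s) -> waiter_wins E f.
Proof.
move: {2}(#|E|) (leqnn #|E|) => m; elim: m E => [|m IH] E.
  by rewrite leqn0 cards_eq0 => /eqP-> _ fs; apply: wins_end.
have [-> _ _ fs|[x xE] Em fE fs] := set_0Vmem E; first exact: wins_end.
apply: (@wins_round E f [set x] (fun _ => f)).
- by rewrite sub1set.
- by rewrite cards1.
- by move=> y _ u v.
- by move=> y /set1P->; apply: fE.
move=> y _; apply: IH => //.
  by move: Em; rewrite (cardsD1 x) xE.
by move=> a /setD1P[_ aE]; apply: fE.
Qed.

Lemma component_monochromatic F f v :
  {in F, forall x, monochromatic f x} ->
  component F v \subset [set u | f u == f v].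
Proof.
move=> mF; apply/subsetP => u; rewrite !inE => /connectP[p].
elim: p v => [|a p IH] v /=; first by move=> _ ->.
case/andP => /andP[_ va] pa /(IH _ pa)/eqP->.
by apply/eqP; apply: (mF _ va); rewrite !inE eqxx ?orbT.
Qed.

(** The derivation is replayed against [sigma]: each [wins_round] continues in the branch of the
    edge that [sigma] picks. Claimed edges stay inside classes, hence so do Client's components. *)
Lemma waiter_wins_sound X (sigma : strategy {set 'I_n}) E f :
  valid_strategy sigma -> waiter_wins E f -> forall h, play_against X q sigma h ->
  unclaimed X h = E -> {in client_claimed h, forall x, monochromatic f x} ->
  exists h', [/\ play_against X q sigma h', unclaimed X h' = set0
    & ~ has_component_geq s (client_claimed h')].
Proof.
move=> vs; elim=> {E f} [f fs h ph h0 mh|E f g fg _ IH h ph hE mh|].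
- exists h; split=> // -[v]; apply/negP; rewrite -ltnNge.
  exact: leq_ltn_trans (subset_leq_card (component_monochromatic v mh)) (fs _).
- by apply: (IH h) => // x xh u v ux vx; apply/fg/(mh x).
move=> E f A g AE /andP[A0 Aq] fg gm _ IH h ph hE mh.
have xA : sigma h A \in A by apply: vs; rewrite -card_gt0.
apply: (IH _ xA (rcons h (A, sigma h A))).
- by apply: play_round; rewrite ?hE ?A0.
- by rewrite unclaimed_rcons hE.
move=> y; rewrite client_claimed_rcons => /setU1P[->|yh]; first exact: gm.
by move=> u v uy vy; apply: (fg _ xA); apply: (mh y).
Qed.

(** For [k = l] this contains every edge that merely touches the class, so bounds are imposed for
    distinct labels only. *)
Definition between E f k l :=
  [set x in E | [exists u in x, exists v in x, (f u == k) && (f v == l)]].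

Lemma betweenP E f k l x :
  reflect (x \in E /\ exists u v, [/\ u \in x, v \in x, f u = k & f v = l])
    (x \in between E f k l).
Proof.
rewrite inE; apply: (iffP andP) => -[xE].
  by case/exists_inP=> u ux /exists_inP[v vx /andP[/eqP uk /eqP vl]]; split=> //; exists u, v.
by case=> u [v [ux vx uk vl]]; split=> //; apply/exists_inP; exists u => //;
  apply/exists_inP; exists v; rewrite // uk vl !eqxx.
Qed.

(* [w] bounds the number of unclaimed edges between two label classes, [z] the
   size of a label class. *)
Definition bounded_by E f w z :=
  [/\ E \subset Kn_edges n, forall k l, k != l -> #|between E f k l| <= w k l
    & forall k, #|[set u | f u == k]| <= z k].

Definition wins_within w z := forall E f, bounded_by E f w z -> waiter_wins E f.

Lemma wins_within_le w' z' w z :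
  (forall k l, k != l -> w k l <= w' k l) -> (forall k, z k <= z' k) ->
  wins_within w' z' -> wins_within w z.
Proof.
move=> ww zz W E f [EK fw fz]; apply: W; split=> // [k l kl|k].
  exact: leq_trans (fw _ _ kl) (ww _ _ kl).
exact: leq_trans (fz _) (zz _).
Qed.

Lemma wins_within0 w z :
  (forall k l, k != l -> w k l = 0) -> (forall k, z k < s) -> wins_within w z.
Proof.
move=> w0 zs E f [_ fw fz]; apply: wins_monochromatic => [x xE u v ux vx|k]; last first.
  exact: leq_ltn_trans (fz k) (zs k).
apply/eqP/negPn/negP => fuv; have := fw _ _ fuv.
rewrite w0 // leqn0 cards_eq0 => /eqP/setP/(_ x).
by rewrite in_set0 => /negP; apply; apply/betweenP; split=> //; exists u, v.
Qed.

(** Label [k] survives as an empty class, whence the zeros in [merge_weight] and [merge_size]. *)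
Definition merge (k l : 'I_n) f := fun u => if f u == k then l else f u.

Definition clear (B : {set 'I_n * 'I_n}) w :=
  fun k l => if ((k, l) \in B) || ((l, k) \in B) then 0 else w k l.

Definition merge_weight (k l : 'I_n) w := fun x y =>
  if (x == k) || (y == k) then 0
  else w x y + (if x == l then w k y else 0) + (if y == l then w x k else 0).

Definition merge_size (k l : 'I_n) z := fun x =>
  if x == k then 0 else if x == l then z l + z k else z x.

Lemma bounded_by_merge E f w z k l : k != l -> bounded_by E f w z ->
  bounded_by E (merge k l f) (merge_weight k l w) (merge_size k l z).
Proof.
move=> kl [EK fw fz]; split=> // [x y xy|x]; last first.
  rewrite /merge_size; case: (eqVneq x k) => [->|xk].
    rewrite leqn0 cards_eq0; apply/eqP/setP => u; rewrite !inE /merge.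
    by case: (eqVneq (f u) k) => [_|/negPf //]; rewrite eq_sym (negPf kl).
  case: (eqVneq x l) => [->|xl].
    apply: leq_trans (leq_add (fz l) (fz k)); apply: leq_trans (leq_card_setU _ _).
    apply: subset_leq_card; apply/subsetP => u; rewrite !inE /merge.
    by case: (f u == k) => [|->]; rewrite ?orbT.
  apply: leq_trans (fz x); apply: subset_leq_card; apply/subsetP => u; rewrite !inE /merge.
  by case: (eqVneq (f u) k) => // _; rewrite eq_sym (negPf xl).
have nk u : merge k l f u <> k.
  by rewrite /merge; case: (eqVneq (f u) k) => [_ /esym/eqP|/eqP //]; rewrite (negPf kl).
rewrite /merge_weight; case: ifPn => [xyk|/norP[xk yk]].
  rewrite leqn0 cards_eq0; apply/eqP/setP => e; rewrite in_set0; apply/negP => /betweenP.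
  by case=> _ [u [v [_ _ ux vy]]]; case/orP: xyk => /eqP ek; [apply: (nk u); rewrite ux
    |apply: (nk v); rewrite vy].
have sub : between E (merge k l f) x y \subset between E f x y
    :|: (if x == l then between E f k y else set0)
    :|: (if y == l then between E f x k else set0).
  apply/subsetP => e /betweenP[eE [u [v [ue ve]]]]; rewrite /merge.
  case: (eqVneq (f u) k) => [fu ux|_ ux]; case: (eqVneq (f v) k) => [fv vy|_ vy].
  - by rewrite -ux -vy eqxx in xy.
  - rewrite -ux eqxx; apply/setUP; left; apply/setUP; right.
    by apply/betweenP; split=> //; exists u, v.
  - rewrite -vy eqxx; apply/setUP; right.
    by apply/betweenP; split=> //; exists u, v.
  apply/setUP; left; apply/setUP; left.
  by apply/betweenP; split=> //; exists u, v.
apply: leq_trans (subset_leq_card sub) _.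
apply: leq_trans (leq_card_setU _ _) _; apply: leq_add.
  apply: leq_trans (leq_card_setU _ _) _; apply: leq_add; first exact: fw.
  by case: ifP => _; [apply: fw; rewrite eq_sym|rewrite cards0].
by case: ifP => _; [apply: fw|rewrite cards0].
Qed.

Lemma bounded_by_clear E E' f w z (B : {set 'I_n * 'I_n}) : E' \subset E ->
  (forall p, p \in B -> between E' f p.1 p.2 = set0) ->
  bounded_by E f w z -> bounded_by E' f (clear B w) z.
Proof.
move=> EE' B0 [EK fw fz]; split=> // [|k l kl]; first exact: subset_trans EK.
have betC a b : between E' f a b = between E' f b a.
  by apply/setP => x; apply/betweenP/betweenP => -[xE [u [v [ux vx ua vb]]]];
    split=> //; exists v, u.
rewrite /clear; case: ifP => [/orP[|]/B0/= h|_]; rewrite ?h ?cards0 //.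
  by rewrite betC h cards0.
apply: leq_trans (fw _ _ kl); apply: subset_leq_card; apply/subsetP => x.
by move=> /betweenP[xE uv]; apply/betweenP; split=> //; apply: (subsetP EE').
Qed.

(** A move at the level of classes: Waiter offers every edge between the pairs in [B]. Whichever
    edge is claimed, one of these pairs merges and all of them are exhausted. *)
Lemma wins_within_round w z (B : {set 'I_n * 'I_n}) :
  B != set0 -> {in B, forall p, p.1 != p.2} ->
  \sum_(p in B) w p.1 p.2 <= q.+1 ->
  {in B, forall p, wins_within (merge_weight p.1 p.2 (clear B w)) (merge_size p.1 p.2 z)} ->
  wins_within w z.
Proof.
move=> /set0Pn[p0 p0B] Bd Bq W E f Efb.
pose A := \bigcup_(p in B) between E f p.1 p.2.
have EA : E :\: A \subset E by exact: subsetDl.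
have cb : bounded_by (E :\: A) f (clear B w) z.
  apply: bounded_by_clear Efb => // p pB; apply/setP => x; rewrite in_set0.
  apply/negP => /betweenP[/setDP[xE /negP xA] uv]; apply: xA.
  by apply/bigcupP; exists p => //; apply/betweenP.
have [EK fw fz] := Efb.
(* A pair of [B] that the edge [x] joins; the default [p0] is in [B] too, so [prB] holds for every
   [x]. *)
pose pr (x : {set 'I_n}) := odflt p0 [pick p in B | x \in between E f p.1 p.2].
have prB x : pr x \in B by rewrite /pr; case: pickP => //= p /andP[].
have co k l : coarser f (merge k l f) by move=> u v; rewrite /merge => ->.
have AE : A \subset E.
  by apply/subsetP => x /bigcupP[p _] /betweenP[].
(* An empty set may not be offered; the merge is then obtained by coarsening alone. *)
have [A0|A0] := eqVneq A set0.
  apply: (wins_coarsen (co p0.1 p0.2)); apply: (W p0 p0B).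
  by rewrite A0 setD0 in cb; apply: bounded_by_merge cb; apply: Bd.
apply: (@wins_round E f A (fun x => merge (pr x).1 (pr x).2 f)) => // [|x|x].
- rewrite card_gt0 A0 /=; apply: leq_trans Bq.
  rewrite /A; elim/big_rec2: _ => [|p a S pB IH]; first by rewrite cards0.
  apply: leq_trans (leq_card_setU _ _) (leq_add _ IH).
  exact/fw/Bd.
- move=> xA; have : x \in between E f (pr x).1 (pr x).2.
    rewrite /pr; case: pickP => [p /andP[]//|]; case/bigcupP: xA => p pB xp.
    by move/(_ p); rewrite pB xp.
  move=> /betweenP[xE [u [v [ux vx fu fv]]]].
  have uv : u != v by apply: contra (Bd _ (prB x)) => /eqP uv; rewrite -fu uv fv.
  have xuv : x = [set u; v].
    apply/esym/eqP; rewrite eqEcard subUset !sub1set ux vx cards2 uv.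
    by move/subsetP: EK => /(_ _ xE); rewrite inE => /eqP->.
  suff mx a : a \in x -> merge (pr x).1 (pr x).2 f a = (pr x).2 by move=> a b /mx-> /mx->.
  rewrite {1}xuv /merge => /set2P[]->; first by rewrite fu eqxx.
  by rewrite fv; case: eqP.
by move=> _; apply: (W _ (prB x)); apply: bounded_by_merge cb; apply: Bd.
Qed.

End WaiterGame.

Lemma CWcomp_lt n q s : 0 < s -> wins_within q s (fun _ _ : 'I_n => 1) (fun=> 1) ->
  CWcomp n q < s.
Proof.
case: (posnP n) => [->|n0 s0 W].
  move=> s0 _; apply: leq_trans s0; rewrite ltnS; apply/bigmax_leqP => i _.
  by rewrite -ltnS.
have [[sigma vs guar] _] := CWcomp_max q n0.
have b : bounded_by (Kn_edges n) id (fun _ _ => 1) (fun=> 1).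
  split=> // [k l kl|k].
    apply: leq_trans (_ : #|[set [set k; l]]| <= _); last by rewrite cards1.
    apply: subset_leq_card; apply/subsetP => x /betweenP[xK [u [v [ux vx /= uk vl]]]].
    rewrite inE in xK; apply/set1P/esym/eqP; rewrite eqEcard subUset !sub1set.
    by rewrite (eqP xK) cards2 kl -uk ux -vl vx.
  apply: leq_trans (_ : #|[set k]| <= _); last by rewrite cards1.
  by apply: subset_leq_card; apply/subsetP => x; rewrite !inE.
have [|x|h [ph h0 nc]] :=
  waiter_wins_sound vs (W _ _ b) (play_start (Kn_edges n) q sigma).
- by rewrite /unclaimed big_nil setD0.
- by rewrite inE.
have [v vc] := guar h ph h0.
rewrite ltnNge; apply/negP => le; apply: nc; exists v; exact: leq_trans vc.
Qed.

(** * One phase of Waiter: pairs, then triples *)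

(* The state of a label class within a phase: outside the game or absorbed by
   another class, untouched, left over without edges to [Fresh] or [Done], union
   of two or of three of the initial classes. *)
Inductive kind := Out | Fresh | Done | Pair | Triple.

Definition is_fresh a := if a is Fresh then true else false.
Definition is_done a := if a is Done then true else false.
Definition is_pair a := if a is Pair then true else false.
Definition is_triple a := if a is Triple then true else false.

(** The unit is the initial bound [e]. One half of a pair has no edge left to fresh classes, so a
    pair has weight 1 to a fresh class and 2 to a later pair. The done class completing a triple
    adds 1 towards pairs and 0 towards triples, so two triples get 3 rather than 9. *)
Definition kind_weight a b := match a, b with
  | Fresh, Fresh | Fresh, Pair | Pair, Fresh | Done, Pair | Pair, Done => 1
  | Pair, Pair => 2
  | Triple, Triple | Triple, Pair | Pair, Triple => 3
  | _, _ => 0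
  end.

Definition kind_size a := match a with Pair => 2 | Triple => 3 | _ => 1 end.

Section Phase.
Variables (n q s : nat).
Implicit Types (e c N r : nat) (t : 'I_n -> kind) (S G : {set 'I_n}).

Definition wins_kinds e c t :=
  wins_within q s (fun k l => e * kind_weight (t k) (t l)) (fun k => c * kind_size (t k)).

Definition wins_uniform e c N := forall S, #|S| <= N ->
  wins_within q s (fun k l => if (k \in S) && (l \in S) then e else 0) (fun=> c).

Lemma wins_kinds_le e c t t' :
  (forall k l, k != l -> kind_weight (t k) (t l) <= kind_weight (t' k) (t' l)) ->
  (forall k, kind_size (t k) <= kind_size (t' k)) ->
  wins_kinds e c t' -> wins_kinds e c t.
Proof.
move=> ww zz; apply: wins_within_le => [k l kl|k]; rewrite leq_mul2l.
  by rewrite ww ?orbT.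
by rewrite zz orbT.
Qed.

Definition pair_up G t a b := fun k : 'I_n =>
  if k == a then Out else if k == b then Pair else if k \in G then Done else t k.

(** All edges from [G] to fresh classes, those inside [G] included, are offered. Once [a] and [b]
    have merged, the rest of [G] has edges only to older pairs. *)
Lemma wins_kinds_pair e c t G a0 b0 :
  (forall k, ~~ is_triple (t k)) -> {in G, forall k, is_fresh (t k)} ->
  a0 \in G -> is_fresh (t b0) -> a0 != b0 ->
  e * (#|G| * #|[set k | is_fresh (t k)]|) <= q.+1 ->
  (forall a b, a \in G -> is_fresh (t b) -> a != b -> wins_kinds e c (pair_up G t a b)) ->
  wins_kinds e c t.
Proof.
move=> nT GF a0G b0F ab0 bud W.
apply: (@wins_within_round _ _ _ _ _
  [set p | (p.1 \in G) && is_fresh (t p.2) && (p.1 != p.2)]).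
- by apply/set0Pn; exists (a0, b0); rewrite inE /= a0G b0F.
- by move=> p; rewrite inE => /andP[].
- apply: leq_trans bud; rewrite -cardsX mulnC -sum_nat_const.
  rewrite [leqLHS](eq_bigr (fun=> e)); last first.
    move=> [x y]; rewrite inE /= => /andP[/andP[/GF xF yF] _].
    by case: (t x) xF => //; case: (t y) yF => //; rewrite muln1.
  rewrite [leqRHS]big_mkcond [leqLHS]big_mkcond /=; apply: leq_sum => -[x y] _.
  by rewrite !inE /=; case: (x \in G); case: (is_fresh _) => //=; case: ifP.
move=> [a b]; rewrite inE /= => /andP[/andP[aG bF] ab].
apply: wins_within_le (W a b aG bF ab) => [x y xy|x].
  rewrite /merge_weight /clear /pair_up !inE /=.
  case: (eqVneq x a) => [//|xa]; case: (eqVneq y a) => [//|ya] /=.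
  have aF := GF _ aG.
  rewrite aG aF (eq_sym y x) xy /= !andbT.
  have {}GF k : k \in G -> t k = Fresh by move=> /GF; case: (t k).
  have {aF}-> : t a = Fresh by case: (t a) aF.
  have {}bF : t b = Fresh by case: (t b) bF.
  move: (nT x) (nT y) (GF x) (GF y) => {nT GF W bud a0G b0F ab0}.
  case: (eqVneq x b) xy => [->|xb]; case: (eqVneq y b) => [->|yb] // _;
    rewrite ?bF ?eqxx ?addn0 //.
  - case: (y \in G) => _ + _ => [_ /(_ isT)->|]; first by case: (b \in G); rewrite ?muln0.
    by case: (t y) => //= _ _; case: (b \in G); rewrite ?muln0 //=; lia.
  - case: (x \in G) => + _ => [_ /(_ isT)->|]; first by case: (b \in G); rewrite ?muln0.
    by case: (t x) => //= _ _; case: (b \in G); rewrite ?muln0 //=; lia.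
  move=> nx ny; case: (x \in G) => [/(_ isT)->|_]; case: (y \in G) => [/(_ isT)->|_] //=.
  - by case: (t y) ny => //= _; rewrite !addn0.
  - by case: (t x) nx => //= _; rewrite !addn0.
rewrite /merge_size /pair_up; have := GF _ aG; have GFx := GF x.
case: (eqVneq x a) => // xa; case: (eqVneq x b) => [_|xb].
  by move=> aF; case: (t a) aF => // _; case: (t b) bF => // _ /=; lia.
by move=> _; case: (x \in G) GFx => //= /(_ isT); case: (t x).
Qed.

Definition complete_triple t d p := fun k : 'I_n =>
  if k == d then Out else if k == p then Triple else t k.

(** [p] is offered to all done classes together, so the new triple has no edge to those that
    remain. *)
Lemma wins_kinds_triple e c t d0 p :
  (forall k, ~~ is_fresh (t k)) -> is_pair (t p) -> is_done (t d0) ->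
  e * #|[set k | is_done (t k)]| <= q.+1 ->
  (forall d, is_done (t d) -> wins_kinds e c (complete_triple t d p)) ->
  wins_kinds e c t.
Proof.
move=> nF pP d0D bud W.
apply: (@wins_within_round _ _ _ _ _
  [set x | is_done (t x.1) && (x.2 == p)]).
- by apply/set0Pn; exists (d0, p); rewrite inE /= d0D eqxx.
- move=> [x y]; rewrite inE /= => /andP[xD /eqP->]; apply/eqP => xp.
  by rewrite xp in xD; case: (t p) pP xD.
- apply: leq_trans bud; rewrite -[#|_|]muln1 -(cards1 p) -cardsX mulnC -sum_nat_const.
  rewrite [leqLHS](eq_bigr (fun=> e)); last first.
    move=> [x y]; rewrite inE /= => /andP[xD /eqP->].
    by case: (t x) xD => //; case: (t p) pP => //; rewrite muln1.
  rewrite [leqRHS]big_mkcond [leqLHS]big_mkcond /=; apply: leq_sum => -[x y] _.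
  by rewrite !inE /=.
move=> [d y]; rewrite inE /= => /andP[dD /eqP->{y}].
have dp : (d == p) = false.
  by apply/eqP => dp; rewrite dp in dD; case: (t p) pP dD.
apply: wins_within_le (W d dD) => [x y xy|x].
  rewrite /merge_weight /clear /complete_triple !inE /=.
  case: (eqVneq x d) => [//|xd]; case: (eqVneq y d) => [//|yd] /=.
  rewrite dD dp /= !andbF /=.
  move: (nF x) (nF y).
  case: (eqVneq x p) xy => [->|xb] xy; case: (eqVneq y p) xy => [->|yb] xy //=;
    rewrite ?eqxx ?(negPf xb) ?(negPf yb) //= ?andbF ?andbT;
    case: (t d) dD => //; case: (t p) pP => //; case: (t x) => //=; case: (t y) => //=; lia.
rewrite /merge_size /complete_triple.
case: (eqVneq x d) => // xd; case: (eqVneq x p) => [_|//].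
by case: (t d) dD => // _; case: (t p) pP => // _ /=; lia.
Qed.

Lemma wins_kinds_stage2 e c N R t :
  e * N <= q.+1 -> wins_uniform (3 * e) (3 * c) R ->
  (forall k, ~~ is_fresh (t k)) -> #|[set k | is_done (t k)]| <= N ->
  #|[set k | is_pair (t k) || is_triple (t k)]| <= R -> wins_kinds e c t.
Proof.
move=> eN W; move: {2}(#|_|) (leqnn #|[set k | is_pair (t k)]|) => m.
elim: m t => [|m IH] t Pm nF DN PR; last first.
  have [P0|[p]] := set_0Vmem [set k | is_pair (t k)].
    by apply: IH => //; rewrite P0 cards0.
  rewrite inE => pP.
  have step u : (forall k, u k = if k == p then Triple else t k) \/
     (exists2 d, is_done (t d) & u = complete_triple t d p) -> wins_kinds e c u.
    move=> uE; apply: IH.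
    - suff /subset_leq_card h : [set k | is_pair (u k)] \subset [set k | is_pair (t k)] :\ p.
        by apply: (leq_trans h); move: Pm; rewrite (cardsD1 p) inE pP add1n ltnS.
      apply/subsetP => k; rewrite !inE; case: uE => [->|[d dD ->]].
        by case: eqP.
      by rewrite /complete_triple; case: eqP => //; case: eqP.
    - move=> k; case: uE => [->|[d dD ->]]; first by case: eqP.
      by rewrite /complete_triple; case: eqP => //; case: eqP.
    - apply: leq_trans DN; apply: subset_leq_card; apply/subsetP => k.
      rewrite !inE; case: uE => [->|[d dD ->]]; first by case: eqP.
      by rewrite /complete_triple; case: eqP => //; case: eqP.
    apply: leq_trans PR; apply: subset_leq_card; apply/subsetP => k.
    rewrite !inE; case: uE => [->|[d dD ->]]; first by case: eqP => // ->; rewrite pP.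
    by rewrite /complete_triple; case: eqP => //; case: eqP => // ->; rewrite pP.
  have [D0|[d0]] := set_0Vmem [set k | is_done (t k)]; last first.
    rewrite inE => d0D; apply: (wins_kinds_triple nF pP d0D).
      by apply: leq_trans eN; rewrite leq_mul2l DN orbT.
    by move=> d dD; apply: step; right; exists d.
  have nD k : ~~ is_done (t k) by move/setP: D0 => /(_ k); rewrite !inE => ->.
  (* With no done class left, [p] is declared a triple at no cost: weights and sizes only grow. *)
  apply: (@wins_kinds_le _ _ _ (fun k => if k == p then Triple else t k)).
  - move=> k l kl; move: (nF k) (nF l) (nD k) (nD l).
    case: (eqVneq k p) kl => [->|kp] kl; case: (eqVneq l p) kl => [->|lp] kl //;
      try (by rewrite eqxx in kl); case: (t p) pP => //; case: (t k); case: (t l) => //.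
  - by move=> k; case: eqP => // _; case: (t k).
  by apply: step; left.
have nP k : ~~ is_pair (t k).
  by move: Pm; rewrite leqn0 cards_eq0 => /eqP/setP/(_ k); rewrite !inE => ->.
(* Neither fresh classes nor pairs are left, so only triples still have edges to one another. *)
apply: wins_within_le (W [set k | is_triple (t k)] _).
- move=> k l kl; rewrite !inE; move: (nF k) (nF l) (nP k) (nP l).
  by case: (t k); case: (t l) => //=; lia.
- by move=> k; move: (nP k); case: (t k) => //=; lia.
apply: leq_trans PR; apply: subset_leq_card; apply/subsetP => k.
by rewrite !inE orbC => ->.
Qed.

(* [covers e u r]: [r] rounds suffice to use up all edges among [u] classes. *)
Inductive covers e : nat -> nat -> Prop :=
| covers0 u : u <= 1 -> covers e u 0
| coversS u g r : 0 < g -> e * (g * u) <= q.+1 -> covers e (u - maxn 2 g) r ->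
    covers e u r.+1.

(** A lone fresh class may count as done: both kinds have weight 1 towards pairs. *)
Lemma wins_kinds_no_fresh_edges e c N R t :
  e * N <= q.+1 -> wins_uniform (3 * e) (3 * c) R ->
  (forall k, ~~ is_triple (t k)) -> #|[set k | is_fresh (t k)]| <= 1 ->
  #|[set k | is_done (t k) || is_fresh (t k)]| <= N ->
  #|[set k | is_pair (t k)]| <= R -> wins_kinds e c t.
Proof.
move=> eN W nT F1 DN PR.
apply: (@wins_kinds_le _ _ _ (fun k => if is_fresh (t k) then Done else t k)).
- move=> k l kl; case: (boolP (is_fresh (t k) && is_fresh (t l))) => [/andP[kF lF]|].
    have : [set k; l] \subset [set k | is_fresh (t k)].
      by rewrite subUset !sub1set !inE kF lF.
    by move/subset_leq_card; rewrite cards2 kl => /leq_trans/(_ F1).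
  by case: (t k); case: (t l).
- by move=> k; case: (t k).
apply: (wins_kinds_stage2 eN W).
- by move=> k; case: (t k).
- apply: leq_trans DN; apply: subset_leq_card; apply/subsetP => k; rewrite !inE.
  by case: (t k).
apply: leq_trans PR; apply: subset_leq_card; apply/subsetP => k.
by rewrite !inE; move: (nT k); case: (t k).
Qed.

Lemma exists_subset_of_card (T : finType) (F : {set T}) g :
  exists2 G : {set T}, G \subset F & #|G| = minn g #|F|.
Proof.
exists [set x in take g (enum F)].
  by apply/subsetP => x; rewrite inE => /mem_take; rewrite mem_enum.
rewrite cardsE (card_uniqP _) ?take_uniq ?enum_uniq // size_take -cardE.
by rewrite minnC /minn; case: ltngtP.
Qed.

(** Each round adds at most one pair and lowers [r] by one, which keeps the bound [R] on their
    sum. *)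
Lemma wins_kinds_stage1 e c N R u r t :
  covers e u r -> e * N <= q.+1 -> wins_uniform (3 * e) (3 * c) R ->
  (forall k, ~~ is_triple (t k)) -> #|[set k | is_fresh (t k)]| <= u ->
  #|[set k | is_done (t k) || is_fresh (t k)]| <= N ->
  #|[set k | is_pair (t k)]| + r <= R -> wins_kinds e c t.
Proof.
move=> cov eN W; elim: cov t => {u r} [u u1|u g r g0 bud cov IH] t nT Fu DN PR.
  by rewrite addn0 in PR; apply: (wins_kinds_no_fresh_edges eN W nT _ DN PR); apply: leq_trans u1.
set F := [set k | is_fresh (t k)] in Fu.
have [F1|F2] := leqP #|F| 1.
  apply: (wins_kinds_no_fresh_edges eN W nT F1 DN).
  by apply: leq_trans PR; apply: leq_addr.
have [G GF cG] := exists_subset_of_card F g.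
have GFt : {in G, forall k, is_fresh (t k)} by move=> k /(subsetP GF); rewrite inE.
have [a0 a0G] : exists a0, a0 \in G by apply/set0Pn; rewrite -card_gt0 cG; lia.
have [b0] : exists b0, b0 \in F :\ a0.
  apply/set0Pn; rewrite -card_gt0; move: F2.
  by rewrite (cardsD1 a0 F) (subsetP GF).
rewrite !inE => /andP[ba b0F].
apply: (wins_kinds_pair nT GFt a0G b0F); first by rewrite eq_sym.
  apply: leq_trans bud; rewrite leq_mul2l leq_mul ?orbT //.
  by rewrite cG; apply: geq_minl.
move=> a b aG bF ab; apply: IH.
- by move=> k; rewrite /pair_up; do 3?case: ifP => // _.
(* Whether or not [b] lies in [G], the set [b |: G] has at least two elements and at least [#|G|];
   this is the source of [maxn 2 g] in [covers]. *)
- have ab2 : 1 < #|b |: G|.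
    suff /subset_leq_card : [set a; b] \subset b |: G by rewrite cards2 ab.
    by rewrite subUset !sub1set !inE aG eqxx orbT.
  have Gb : minn g #|F| <= #|b |: G| by rewrite -cG subset_leq_card // subsetUr.
  have bGF : b |: G \subset F by rewrite subUset sub1set inE bF.
  have : #|[set k | is_fresh (pair_up G t a b k)]| <= #|F :\: (b |: G)|.
    apply: subset_leq_card; apply/subsetP => k; rewrite !inE /pair_up.
    by case: eqP => // _; case: eqP => // _; case: ifP.
  have := subset_leq_card bGF.
  by rewrite cardsDS //; lia.
- apply: leq_trans DN; apply: subset_leq_card; apply/subsetP => k; rewrite !inE /pair_up.
  case: eqP => // _; case: eqP => // _; case: ifP => // /GFt->; by rewrite orbT.
have : #|[set k | is_pair (pair_up G t a b k)]| <= #|b |: [set k | is_pair (t k)]|.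
  apply: subset_leq_card; apply/subsetP => k; rewrite !inE /pair_up.
  by case: eqP => // _; case: eqP => // _; case: ifP.
by have := cardsU1 b [set k | is_pair (t k)]; lia.
Qed.

Lemma wins_uniform_phase e c N r :
  covers e N r -> e * N <= q.+1 -> wins_uniform (3 * e) (3 * c) r -> wins_uniform e c N.
Proof.
move=> cov eN W S SN.
have : wins_kinds e c (fun k => if k \in S then Fresh else Out).
  apply: (wins_kinds_stage1 (N := N) cov eN W) => [k|||].
  - by case: ifP.
  - by apply: leq_trans SN; apply: subset_leq_card; apply/subsetP => k; rewrite inE; case: ifP.
  - by apply: leq_trans SN; apply: subset_leq_card; apply/subsetP => k; rewrite inE; case: ifP.
  rewrite (_ : [set k | _] = set0) ?cards0 //.
  by apply/setP => k; rewrite !inE; case: ifP.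
apply: wins_within_le => [k l kl|k]; last by case: ifP; rewrite muln1.
by case: ifP => [/andP[-> ->]|//]; rewrite muln1.
Qed.

Lemma wins_uniform_le e c N e' c' N' :
  e <= e' -> c <= c' -> N <= N' -> wins_uniform e' c' N' -> wins_uniform e c N.
Proof.
move=> ee cc NN W S SN; apply: wins_within_le (W S (leq_trans SN NN)) => // k l _.
by case: ifP.
Qed.

(** One offer takes all edges between the classes; a single pair merges, giving size at most
    [2 * c]. *)
Lemma wins_uniform_last e c N : e * (N * N) <= q.+1 -> 2 * c < s -> wins_uniform e c N.
Proof.
move=> eN cs S SN.
have [S1|S2] := leqP #|S| 1.
  apply: wins_within0 => [k l kl|k]; last by lia.
  case: ifP => // /andP[kS lS]; have : [set k; l] \subset S by rewrite subUset !sub1set kS.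
  by move/subset_leq_card; rewrite cards2 kl => /leq_trans/(_ S1).
apply: (@wins_within_round _ _ _ _ _ [set p | [&& p.1 \in S, p.2 \in S & p.1 != p.2]]).
- by have /card_gt1P[a [b [aS bS ab]]] := S2; apply/set0Pn; exists (a, b); rewrite inE /= aS bS.
- by move=> p; rewrite inE => /and3P[].
- have : e * (#|S| * #|S|) <= q.+1.
    by apply: leq_trans eN; rewrite leq_mul2l leq_mul ?orbT.
  apply: leq_trans; rewrite -cardsX mulnC -sum_nat_const.
  rewrite [leqLHS](eq_bigr (fun=> e)); last by move=> [x y]; rewrite inE /= => /and3P[-> ->].
  rewrite [leqRHS]big_mkcond [leqLHS]big_mkcond /=; apply: leq_sum => -[x y] _.
  by rewrite !inE /=; case: (x \in S); case: (y \in S) => //=; case: ifP.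
move=> [a b] _; apply: wins_within0 => [x y xy|x] /=.
  rewrite /merge_weight /clear !inE /=.
  by case: (eqVneq x a) => // xa; case: (eqVneq y a) => //= ya;
    case: (eqVneq x b) xy => [->|xb] xy; case: (eqVneq y b) xy => [->|yb] //=;
    move=> xy; rewrite ?eqxx // ?(eq_sym y x) ?(negPf xy);
    case: (a \in S); case: (b \in S); case: (x \in S); case: (y \in S);
    rewrite ?andbT ?andbF ?orbT ?orbF //=; case: ifP.
rewrite /merge_size; case: ifP => _; first by lia.
by case: ifP => _; lia.
Qed.

End Phase.

(** * Counting the rounds of a phase *)

Lemma covers_nil q e r : covers q e 0 r.
Proof.
by elim: r => [|r IH]; [apply: covers0|apply: (@coversS _ _ 0 1); rewrite ?muln0].
Qed.

(* With [g = q %/ (e * u)] a round decreases [2 * e * u ^ 2] by at least [q]. *)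
Lemma covers_crude q e u r : 0 < r -> e * u <= q -> 2 * (e * (u * u)) < q * r.+1 ->
  covers q e u r.
Proof.
elim/ltn_ind: u r => u IH [//|r] _ eu euu.
have [->|u0] := posnP u; first exact: covers_nil.
have [e0|e0] := posnP e.
  rewrite e0 in IH *; apply: (@coversS _ _ _ u) => //.
  by rewrite (_ : u - _ = 0); [apply: covers_nil|lia].
have [small|big] := leqP (e * (u * u)) q.
  apply: (@coversS _ _ _ u) => //; first lia.
  by rewrite (_ : u - _ = 0); [apply: covers_nil|lia].
have eu0 : 0 < e * u by rewrite muln_gt0 e0.
pose g := q %/ (e * u).
have g0 : 0 < g by rewrite divn_gt0.
have gle : g * (e * u) <= q by apply: leq_trunc_div.
have ggt : q < g.+1 * (e * u) by rewrite ltn_ceil.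
have gu : g <= u.
  rewrite leqNgt; apply/negP => ug.
  have : u * (e * u) <= g * (e * u) by rewrite leq_mul2r (ltnW ug) orbT.
  by move: gle big; lia.
have [v uE] : exists v, u = v + g by exists (u - g); rewrite subnK.
apply: (@coversS _ _ _ g) => //; first lia.
have vle : u - maxn 2 g <= v by lia.
have ev : e * (u - maxn 2 g) <= e * v by rewrite leq_mul2l vle orbT.
apply: IH; [lia| |lia|].
  (* [big] forces [r] to be positive, as [2 * q < q * r.+2]. *)
  by move: big euu; case: r; lia.
have : e * ((u - maxn 2 g) * (u - maxn 2 g)) <= e * (v * v).
  by rewrite leq_mul2l leq_mul ?orbT.
(* Together with [ggt] this yields [q < 2 * (e * (g * u))], while [u ^ 2 - v ^ 2] is at least
   [g * u]. *)
have gg : e * (g * u) >= e * u by rewrite leq_mul2l leq_pmull ?orbT.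
have : e * (u * u) >= e * (v * v) + e * (g * u).
  by rewrite -mulnDr leq_mul2l uE; apply/orP; right; lia.
by move: euu; rewrite mulnS; move: ggt; rewrite mulSn; lia.
Qed.

Lemma covers_piece q e g L U r m : 0 < g -> (forall u, u <= L -> covers q e u r) ->
  e * (g * U) <= q -> U <= L + maxn 2 g * m ->
  forall u, u <= U -> covers q e u (m + r).
Proof.
move=> g0 HL; elim: m U => [|m IH] U eU UL u uU.
  by apply: HL; apply: leq_trans uU _; rewrite muln0 addn0 in UL.
apply: (@coversS _ _ _ g) => //.
  have : e * (g * u) <= e * (g * U) by rewrite !leq_mul2l uU !orbT.
  by lia.
apply: (IH (U - maxn 2 g)); [|by lia|by lia].
have : e * (g * (U - maxn 2 g)) <= e * (g * U) by rewrite !leq_mul2l leq_subr !orbT.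
by lia.
Qed.

(** * Squaring phases, and a finer count of rounds *)

Section Strategy.
Variables (n q s : nat).

(* [6 * e * N / q] is squared by each phase. *)
Lemma wins_squaring j e c N : 0 < q -> 6 * (e * N) <= q ->
  q * (6 * (e * N)) ^ (2 ^ j.+1) <= 6 * q ^ (2 ^ j.+1) ->
  2 * (3 ^ j * c) < s -> wins_uniform n q s e c N.
Proof.
move=> q0; elim: j e c N => [|j IH] e c N eN eNq cs.
  apply: wins_uniform_last; last by lia.
  (* So [6 * (e * N) ^ 2 <= q], and [e * N ^ 2 <= (e * N) ^ 2] for positive [e]: one offer
     suffices. *)
  have : q * (36 * ((e * N) * (e * N))) <= q * (6 * q) by move: eNq; rewrite !expn1; lia.
  rewrite leq_pmul2l // => h.
  case: (posnP e) h => [->//|e0] h.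
  have : 1 * (e * (N * N)) <= e * (e * (N * N)) by rewrite leq_mul2r e0 orbT.
  by lia.
have [small|big] := leqP (e * (N * N)) q.+1.
  apply: wins_uniform_last => //; apply: leq_ltn_trans cs.
  by rewrite leq_mul2l leq_pmull ?expn_gt0.
pose r := (2 * (e * (N * N))) %/ q.
have rle : r * q <= 2 * (e * (N * N)) by apply: leq_trunc_div.
have rgt : 2 * (e * (N * N)) < r.+1 * q by rewrite ltn_ceil.
have r0 : 0 < r by rewrite divn_gt0 //; lia.
(* The constant 6 is the 3 from tripling [e] times the 2 in the bound on [r]; with it the squaring
   is exact. *)
have sq : 6 * (3 * e * r) * q <= (6 * (e * N)) * (6 * (e * N)).
  have : e * (r * q) <= e * (2 * (e * (N * N))) by rewrite leq_mul2l rle orbT.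
  by lia.
apply: (@wins_uniform_phase _ _ _ _ _ _ r); [|by lia|].
  by apply: (covers_crude r0); [lia|rewrite (mulnC q)].
apply: IH; last by move: cs; rewrite expnS; lia.
  rewrite -(leq_pmul2r q0); apply: leq_trans sq _; exact: (leq_mul eN eN).
rewrite -(@leq_pmul2r (q ^ 2 ^ j.+1)) ?expn_gt0 ?q0 //.
rewrite -mulnA -expnMn -[leqRHS]mulnA -expnD addnn -mul2n -expnS.
apply: leq_trans eNq; rewrite leq_mul2l (expnS 2 j.+1) expnM.
by rewrite leq_exp2r ?expn_gt0 // -[_ ^ 2]mulnn sq orbT.
Qed.

(* While [8 * N / (5 * h) < u <= 8 * N / (5 * g)], each round uses up [g] classes. *)
Fixpoint rounds_rate (g : nat) (gs : seq nat) : rat :=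
  if gs is h :: gs' then ((g%:R^-1 - h%:R^-1) / g%:R + rounds_rate h gs')%R
  else (g%:R^-1 / g%:R)%R.

(** Given [8 * (e * N) <= 5 * q], groups of size [g] fit the budget once at most this many classes
    are untouched. *)
Definition piece_end N g := (8 * N) %/ (5 * g).

(** The list is treated from its end: after the rounds for [h :: gs] are known, rounds of size [g]
    lead from [piece_end N g] down to [piece_end N h]. Rounding costs at most 2 rounds per piece. *)
Lemma covers_pieces e N g gs : 8 * (e * N) <= 5 * q -> 1 < g -> path ltn g gs ->
  exists2 r, (r%:R <= 8 / 5 * rounds_rate g gs * N%:R + 2 * (size gs).+1%:R)%R &
    forall u, u <= piece_end N g -> covers q e u r.
Proof.
move=> eN.
have step h L m r : 1 < h -> (forall u, u <= L -> covers q e u r) ->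
    m = ((piece_end N h - L) %/ h).+1 ->
    forall u, u <= piece_end N h -> covers q e u (m + r).
  move=> h1 H ->; apply: (covers_piece (g := h) _ H); first by lia.
    have : e * (piece_end N h * (5 * h)) <= e * (8 * N).
      by rewrite leq_mul2l leq_trunc_div orbT.
    by lia.
  rewrite (maxn_idPr h1) mulnC.
  by have := @ltn_ceil (piece_end N h - L) h (ltnW h1); lia.
have eqf h : 0 < h -> (8 / 5 * (h%:R^-1 * N%:R) = (8 * N%:R) / (5 * h%:R) :> rat)%R.
  by move=> h0; field; rewrite pnatr_eq0 -lt0n.
have upper h : 0 < h -> ((piece_end N h)%:R <= 8 / 5 * (h%:R^-1 * N%:R) :> rat)%R.
  move=> h0; rewrite eqf // ler_pdivlMr ?mulr_gt0 ?ltr0n // -!natrM ler_nat.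
  exact: leq_trunc_div.
have lower h : 0 < h -> (8 / 5 * (h%:R^-1 * N%:R) <= (piece_end N h)%:R + 1 :> rat)%R.
  move=> h0; rewrite eqf // ler_pdivrMr ?mulr_gt0 ?ltr0n // natr1 -!natrM ler_nat.
  by apply/ltnW/ltn_ceil; rewrite muln_gt0.
(* [y] is the exact real endpoint that [L] approximates to within 1; using it makes the sum
   telescope into [rounds_rate]. *)
have bound h (L : nat) (y : rat) :
    1 < h -> (y <= L%:R + 1)%R -> (y <= 8 / 5 * (h%:R^-1 * N%:R))%R ->
    ((((piece_end N h - L) %/ h).+1)%:R <= (8 / 5 * (h%:R^-1 * N%:R) - y) / h%:R + 2 :> rat)%R.
  move=> h1 yL yh; have h0 : (0 < h%:R :> rat)%R by rewrite ltr0n ltnW.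
  have h2 : (2 <= h%:R :> rat)%R by rewrite (ler_nat rat 2).
  have := upper h (ltnW h1); move: (piece_end N h) => P up.
  have [PL|LP] := leqP P L.
    rewrite (eqP (PL : P - L == 0)) div0n.
    have : (0 <= (8 / 5 * (h%:R^-1 * N%:R) - y) / h%:R)%R by rewrite divr_ge0 ?subr_ge0 // ltW.
    by lra.
  have := leq_trunc_div (P - L) h; rewrite -(ler_nat rat); move: (_ %/ h) => d.
  rewrite natrM natrB; last exact: ltnW.
  rewrite -ler_pdivlMr; last exact: h0.
  rewrite -(natr1 d) => mle.
  have : ((P%:R - L%:R) / h%:R <= (8 / 5 * (h%:R^-1 * N%:R) - y + 1) / h%:R)%R.
    by rewrite ler_pM2r ?invr_gt0 //; lra.
  rewrite mulrDl => le2; have : (1 / h%:R <= 1 :> rat)%R by rewrite ler_pdivrMr // mul1r; lra.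
  by lra.
elim: gs g => [|h gs IH] g g1 /=.
  move=> _; exists (((piece_end N g - 0) %/ g).+1 + 0).
    have y0 : (0 <= 8 / 5 * (g%:R^-1 * N%:R) :> rat)%R.
      by apply: mulr_ge0; [lra|apply: mulr_ge0; rewrite ?invr_ge0 ler0n].
    rewrite addn0; apply: (le_trans (bound g 0 0%R g1 _ y0)).
      by rewrite mulr0n add0r ler01.
    rewrite le_eqVlt; apply/orP; left; apply/eqP; ring.
  apply: step => // u; rewrite leqn0 => /eqP->; exact: covers0.
case/andP=> gh hgs; have h1 := ltn_trans g1 gh; have [r rle H] := IH h h1 hgs.
exists (((piece_end N g - piece_end N h) %/ g).+1 + r); last exact: step H _.
have h0 := ltnW h1; have := bound g (piece_end N h) (8 / 5 * (h%:R^-1 * N%:R))%R g1 (lower h h0) _.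
rewrite natrD; set m := (_ %/ _).+1.
have -> : ((8 / 5 * (g%:R^-1 * N%:R) - 8 / 5 * (h%:R^-1 * N%:R)) / g%:R =
    8 / 5 * ((g%:R^-1 - h%:R^-1) / g%:R * N%:R) :> rat)%R by ring.
move=> /(_ _) mle; have {}mle := mle _; rewrite -(natr1 (size gs).+1).
have /mle : (8 / 5 * (h%:R^-1 * N%:R) <= 8 / 5 * (g%:R^-1 * N%:R) :> rat)%R.
  apply: ler_wpM2l; first by lra.
  apply: ler_wpM2r; first by rewrite ler0n.
  by rewrite lef_pV2 ?posrE ?ltr0n ?(ltnW g1) // ler_nat ltnW.
by lra.
Qed.

(** The rates add up to about 0.33307, just below the 1/3 needed to offset the tripling of [e]; this
    fixes how fine the list is. The lower bound on [N] absorbs the additive [26 + 3 / 2]. *)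
Lemma covers_fine e N : 8 * (e * N) <= 5 * q -> 600 * 600 <= N ->
  exists2 r, covers q e N r & 3000 * (3 * r) <= 2999 * N.
Proof.
move=> eN N0.
have [r rle H] := covers_pieces eN (isT : 1 < 3)
  (isT : path ltn 3 [:: 4; 5; 6; 7; 8; 10; 12; 15; 20; 30; 50; 100]).
exists (((N - piece_end N 3) %/ 2).+1 + r).
  (* A group of size 1 also removes two classes, and it is affordable already at [u = N]. *)
  apply: (covers_piece (g := 1) _ H) (leqnn N) => //; first by lia.
  by rewrite /maxn /=; have := @ltn_ceil (N - piece_end N 3) 2 isT; lia.
have : ((((N - piece_end N 3) %/ 2).+1)%:R <= 7 / 30 * N%:R + 3 / 2 :> rat)%R.
  have p1 := @ltn_ceil (8 * N) (5 * 3) isT; have p2 := leq_trunc_div (N - piece_end N 3) 2.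
  have : 30 * ((N - piece_end N 3) %/ 2).+1 <= 7 * N + 45.
    by move: p1 p2; rewrite -/(piece_end N 3); lia.
  clear; move: (_ %/ 2).+1 => m.
  by rewrite -(ler_nat rat) natrD 2!natrM; lra.
rewrite -(ler_nat rat) 3!natrM natrD.
have : (600%:R * 600%:R <= N%:R :> rat)%R by rewrite -natrM ler_nat.
move: rle; rewrite /= => h1 h2 h3; move: h1 h2 h3.
set m := (_ %/ 2).+1; lra.
Qed.
End Strategy.

(** * Constant-factor phases and the combinatorial upper bounds *)

(** [N'] is the rounded-down [2999 * N / 9000] instead of the number of rounds, so that it stays
    above [N / 4] and the phase can be repeated. *)
Lemma wins_uniform_fine : exists N0, forall n q s e c N, 8 * (e * N) <= 5 * q -> N0 <= N ->
  exists N', [/\ N <= 4 * N', 3000 * (3 * N') <= 2999 * N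
    & wins_uniform n q s (3 * e) (3 * c) N' -> wins_uniform n q s e c N].
Proof.
exists (maxn 30 (600 * 600)) => n q s e c N eN; rewrite geq_max => /andP[N30 N0].
have [r cov rN] := covers_fine eN N0.
move: (600 * 600) N0 => K _ {K}.
have h1 := leq_trunc_div (2999 * N) (3000 * 3).
have h2 := @ltn_ceil (2999 * N) (3000 * 3) isT.
move: (_ %/ _) h1 h2 => N' h1 h2.
exists N'; split; [lia|lia|] => W.
apply: (wins_uniform_phase cov); first by lia.
by apply: wins_uniform_le W => //; lia.
Qed.

Lemma wins_uniform_fine_iter J : exists N0, forall n q s e c N,
  8 * (e * N) <= 5 * q -> N0 <= N ->
  exists2 N', 3000 ^ J * (3 ^ J * N') <= 2999 ^ J * N
    & wins_uniform n q s (3 ^ J * e) (3 ^ J * c) N' -> wins_uniform n q s e c N.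
Proof.
have [N1 fine] := wins_uniform_fine.
elim: J => [|J [N0 IH]].
  by exists 0 => n q s e c N _ _; exists N; rewrite ?expn0 ?mul1n.
exists (maxn N1 (4 * N0)) => n q s e c N eN; rewrite geq_max => /andP[NN1 NN0].
have [N2 [NN2 N2N W]] := fine n q s e c N eN NN1.
have e2 : 8 * (3 * e * N2) <= 5 * q.
  have : e * (3000 * (3 * N2)) <= e * (2999 * N) by rewrite leq_mul2l N2N orbT.
  by lia.
have [|N3 N3N W3] := IH n q s (3 * e) (3 * c) N2 e2; first by lia.
exists N3; last by rewrite !expnSr -!mulnA => /W3.
rewrite !expnS.
have : 3000 * 3 * (3000 ^ J * (3 ^ J * N3)) <= 3000 * 3 * (2999 ^ J * N2).
  by rewrite leq_mul2l N3N orbT.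
have : 2999 ^ J * (3000 * (3 * N2)) <= 2999 ^ J * (2999 * N) by rewrite leq_mul2l N2N orbT.
move: (3000 ^ J) (2999 ^ J) (3 ^ J) => a b d; clear; lia.
Qed.

(** Bernoulli's inequality, with denominators cleared in [H]. *)
Lemma exists_power_ratio K b : 0 < b -> exists J, K * b ^ J <= b.+1 ^ J.
Proof.
move=> b0; exists (K * b).
have H J : (b + J) * b ^ J <= b * b.+1 ^ J.
  elim: J => [|J IH]; first by rewrite !expn0 addn0.
  rewrite !expnS; have := leq_mul (leqnn b.+1) IH.
  move: (b ^ J) (b.+1 ^ J) => x y; have := leq0n x; nia.
rewrite -(leq_pmul2l b0); apply: leq_trans (H _).
by rewrite mulnA leq_mul2r (mulnC b) leq_addl orbT.
Qed.

(** If [q <= n * n], the powers of 2 gained from [2 * A <= q] pay for the factor [q]. Otherwise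
    [A ^ 2 <= q], and half of the exponent is saved. *)
Lemma expn_le_of_square A n q j : 0 < q -> 2 * A <= q -> A <= n -> n * n <= 2 ^ (2 ^ j.+1) ->
  q * A ^ (2 ^ j.+1) <= q ^ (2 ^ j.+1).
Proof.
move=> q0 Aq An nM; have [qn|nq] := leqP q (n * n).
  have := leq_exp2r (2 * A) q (_ : 0 < 2 ^ j.+1); rewrite expn_gt0 => /(_ isT).
  rewrite Aq expnMn => h; apply: leq_trans h.
  by rewrite leq_mul2r (leq_trans qn) ?orbT.
have m0 : 0 < 2 ^ j by rewrite expn_gt0.
rewrite expnS expnM -[in leqRHS](prednK m0) mulnS mul2n -addnn expnD.
have Aq2 : A ^ 2 <= q by rewrite -mulnn; apply: leq_trans (ltnW nq); apply: leq_mul.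
rewrite -[2 ^ j in leqLHS](prednK m0) expnS.
apply: (@leq_trans (q * (q * q ^ (2 ^ j).-1))).
  by rewrite leq_mul2l leq_mul ?orbT //; case: (_.-1) => // k; rewrite leq_exp2r.
by rewrite expnD [q ^ 2]expnS expn1 -!mulnA !leq_mul // leq_pmull // expn_gt0 q0.
Qed.

Lemma CWcomp_lt_of_squaring n q j : 0 < q -> 6 * n <= q ->
  q * (6 * n) ^ (2 ^ j.+1) <= 6 * q ^ (2 ^ j.+1) -> CWcomp n q < 3 ^ j.+1.
Proof.
move=> q0 nq h; apply: CWcomp_lt; first by rewrite expn_gt0.
have : wins_uniform n q (3 ^ j.+1) 1 1 n.
  by apply: (wins_squaring (j := j)) => //; rewrite ?mul1n ?muln1 // expnS ltn_pmul2r ?expn_gt0.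
move/(_ [set: 'I_n]); rewrite cardsT card_ord => /(_ (leqnn n)).
by apply: wins_within_le => // k l _; rewrite !inE.
Qed.

(** [J] phases bring [3 ^ J * N] down to [n / 8]; then [A = 6 * (3 ^ J * N)] satisfies [A <= n] and
    [2 * A <= q], so squaring applies. *)
Lemma CWcomp_lt_of_linear : exists J n0, forall n q j, n0 <= n -> 0 < q -> 8 * n <= 5 * q ->
  n * n <= 2 ^ (2 ^ j.+1) -> CWcomp n q < 3 ^ (J + j.+1).
Proof.
have [J JP] := @exists_power_ratio 8 2999 isT; have [n0 H] := wins_uniform_fine_iter J.
exists J, n0 => n q j nn0 q0 nq nj.
have [|N NJ W] := H n q (3 ^ (J + j.+1)) 1 1 n _ nn0; first by rewrite mul1n.
have N8 : 8 * (3 ^ J * N) <= n.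
  have b0 : 0 < 3000 ^ J by rewrite expn_gt0.
  move: (3000 ^ J) (2999 ^ J) (3 ^ J * N) b0 JP NJ => a b x b0 JP NJ.
  rewrite -(leq_pmul2l b0) mulnCA; apply: leq_trans (leq_mul (leqnn 8) NJ) _.
  by rewrite mulnA leq_mul2r JP orbT.
apply: CWcomp_lt; first by rewrite expn_gt0.
have : wins_uniform n q (3 ^ (J + j.+1)) 1 1 n.
  apply: W; rewrite !muln1; apply: (wins_squaring (j := j)) => //; first by lia.
    apply: leq_trans (_ : q ^ 2 ^ j.+1 <= _); last by rewrite leq_pmull.
    by apply: expn_le_of_square nj => //; lia.
  by rewrite -expnD addnS expnS addnC ltn_pmul2r ?expn_gt0.
move/(_ [set: 'I_n]); rewrite cardsT card_ord => /(_ (leqnn n)).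
by apply: wins_within_le => // k l _; rewrite !inE.
Qed.

(** * Client's greedy strategy *)

Section Client.
Variable n : nat.
Implicit Types (F : {set {set 'I_n}}) (e : {set 'I_n}).

Lemma component_sym F u v : (u \in component F v) = (v \in component F u).
Proof.
rewrite !inE; apply: sym_connect_sym => a b.
by rewrite /adj eq_sym setUC.
Qed.

Lemma component_eq F u v : u \in component F v -> component F u = component F v.
Proof.
move=> uv; have vu := uv; rewrite component_sym in vu.
rewrite inE in uv; rewrite inE in vu; apply/setP => w; rewrite !inE.
by apply/idP/idP; apply: connect_trans.
Qed.

Lemma component_refl F v : v \in component F v.
Proof. by rewrite inE connect0. Qed.

Lemma component_mono F F' v : F \subset F' -> component F v \subset component F' v.
Proof.
move=> FF; apply/subsetP => u; rewrite !inE; apply: connect_sub => a b /andP[ab abF].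
by apply: connect1; rewrite /adj ab (subsetP FF).
Qed.

Definition components F := [set component F v | v in 'I_n].

Definition joining F e := ~~ [exists v, e \subset component F v].

(** Adding edges only merges components, so any element of [C] can represent it. *)
Definition next_component F' (C : {set 'I_n}) := oapp (component F') C [pick v in C].

Lemma next_componentE F F' v : F \subset F' ->
  next_component F' (component F v) = component F' v.
Proof.
move=> FF; rewrite /next_component; case: pickP => [u /= uv|/(_ v)]; last first.
  by rewrite /= component_refl.
exact/component_eq/(subsetP (component_mono v FF)).
Qed.

Lemma components_next F F' : F \subset F' ->
  components F' = next_component F' @: components F.
Proof.
move=> FF; rewrite /components -imset_comp; apply: eq_imset => v /=.
by rewrite next_componentE.
Qed.

Lemma card_components_le F F' : F \subset F' -> #|components F'| <= #|components F|.
Proof. by move=> FF; rewrite (components_next FF) leq_imset_card. Qed.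

(** An unchanged count would make [next_component] injective, yet it identifies the components of
    the two ends of [e]. *)
Lemma card_components_joining F e : e \in Kn_edges n -> joining F e ->
  #|components (e |: F)| < #|components F|.
Proof.
rewrite inE => /cards2P[u [v [uv ->]]] je.
have FF : F \subset [set u; v] |: F by apply: subsetUr.
rewrite ltn_neqAle card_components_le // andbT (components_next FF).
apply: contra je => /imset_injP inj.
have uvF : component F u = component F v.
  apply: inj; rewrite ?imset_f // !next_componentE //.
  by apply: component_eq; rewrite inE connect1 // /adj eq_sym uv setUC setU11.
by apply/existsP; exists u; rewrite subUset !sub1set component_refl uvF component_refl.
Qed.

Definition greedy : strategy {set 'I_n} := fun h A =>
  if [pick e in A | joining (client_claimed h) e] is Some e then e
  else odflt set0 [pick e in A].

Lemma greedy_valid : valid_strategy greedy.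
Proof.
move=> h A /set0Pn[x xA]; rewrite /greedy; case: pickP => [e /andP[]//|_].
by case: pickP => [//|/(_ x)]; rewrite xA.
Qed.

Lemma unclaimed_sub (X : {set {set 'I_n}}) (h : history {set 'I_n}) : unclaimed X h \subset X.
Proof. exact: subsetDl. Qed.

(** A potential argument: a round offering a joining edge adds at most [q.+1] joining claimed edges
    but removes a component; in any other round no offered edge is joining, now or later. *)
Lemma greedy_bound q h : play_against (Kn_edges n) q greedy h ->
  #|[set e in Kn_edges n :\: unclaimed (Kn_edges n) h | joining (client_claimed h) e]|
    + q.+1 * #|components (client_claimed h)| <= q.+1 * n.
Proof.
elim=> {h} [|h A _ IH AU /andP[A0 Aq]].
  rewrite /unclaimed big_nil setD0 setDv.
  rewrite (_ : [set e in _ | _] = set0) ?cards0; last by apply/setP => e; rewrite !inE.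
  by rewrite leq_mul2l -[leqRHS]card_ord leq_imset_card orbT.
rewrite client_claimed_rcons unclaimed_rcons.
set F := client_claimed h in IH *; set x := greedy h A; set U := unclaimed _ h in IH AU *.
have FF : F \subset x |: F by apply: subsetUr.
have jF e : joining (x |: F) e -> joining F e.
  apply: contra => /existsP[v ev]; apply/existsP; exists v.
  exact: subset_trans ev (component_mono v FF).
have [[e eA je]|nj] : (exists2 e, e \in A & joining F e) \/ {in A, forall e, ~~ joining F e}.
  have [e /andP[eA je]|no] := pickP [pred e in A | joining F e].
    by left; exists e.
  by right=> e eA; have := no e; rewrite /= eA /= => ->.
- have [xA jx] : x \in A /\ joining F x.
    by rewrite /x /greedy; case: pickP => [a /andP[]//|/(_ e)]; rewrite eA je.
  have xK : x \in Kn_edges n by apply: (subsetP (unclaimed_sub _ h)); apply: (subsetP AU).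
  have dec := card_components_joining xK jx.
  have : #|[set e in Kn_edges n :\: (U :\: A) | joining (x |: F) e]|
      <= #|[set e in Kn_edges n :\: U | joining F e] :|: A|.
    apply: subset_leq_card; apply/subsetP => a; rewrite !inE.
    case: (boolP (a \in A)) => [_|_] /=; first by rewrite orbT.
    by case/andP=> -> /jF->.
  move/leq_trans/(_ (leq_card_setU _ _)) => le.
  have : q.+1 * #|components (x |: F)|.+1 <= q.+1 * #|components F| by rewrite leq_mul2l dec orbT.
  by rewrite mulnS; lia.
have : #|[set e in Kn_edges n :\: (U :\: A) | joining (x |: F) e]|
    <= #|[set e in Kn_edges n :\: U | joining F e]|.
  apply: subset_leq_card; apply/subsetP => a; rewrite !inE.
  case: (boolP (a \in A)) => [aA|_] /= /andP[aK /jF ja]; first by have := nj a aA; rewrite ja.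
  by rewrite aK.
have : q.+1 * #|components (x |: F)| <= q.+1 * #|components F|.
  by rewrite leq_mul2l card_components_le ?orbT.
by lia.
Qed.

(** Both sides concern ordered pairs of vertices in distinct components; each joining edge gives at
    most two. *)
Lemma disconnected_pairs F :
  \sum_(v : 'I_n) (n - #|component F v|) <= 2 * #|[set e in Kn_edges n | joining F e]|.
Proof.
pose P := [set p : 'I_n * 'I_n | p.2 \notin component F p.1].
have -> : \sum_v (n - #|component F v|) = #|P|.
  transitivity (\sum_v \sum_(u | u \notin component F v) 1).
    apply: eq_bigr => v _; rewrite sum1_card.
    by have := cardC (mem (component F v)); rewrite card_ord; move: #|_| => a; set b := #|_|; lia.
  by rewrite pair_big_dep -sum1_card; apply: eq_bigl => p; rewrite !inE.
pose Q (e : {set 'I_n}) := [set p : 'I_n * 'I_n | [&& p.1 \in e, p.2 \in e & p.1 != p.2]].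
have : P \subset \bigcup_(e in [set e in Kn_edges n | joining F e]) Q e.
  apply/subsetP => -[a b]; rewrite inE /= => nab.
  have ab : a != b by apply: contra nab => /eqP->; apply: component_refl.
  apply/bigcupP; exists [set a; b]; last by rewrite !inE /= !eqxx ab orbT.
  rewrite !inE cards2 ab /=; apply: contra nab => /existsP[v].
  by rewrite subUset !sub1set => /andP[/component_eq->].
move/subset_leq_card/leq_trans; apply; rewrite mulnC -sum_nat_const.
elim/big_rec2: _ => [|e a S]; first by rewrite cards0.
rewrite inE => /andP[+ _] IH; rewrite inE => /cards2P[u [v [uv ->]]].
apply: leq_trans (leq_card_setU _ _) (leq_add _ IH).
apply: leq_trans (_ : #|[set (u, v); (v, u)]| <= 2); last by rewrite cards2; case: eqP.
apply: subset_leq_card; apply/subsetP => -[x y]; rewrite !inE /=.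
case/and3P => /orP[]/eqP-> /orP[]/eqP->; by rewrite ?eqxx ?orbT.
Qed.

Lemma can_force_of_bias q s : 0 < n -> s + 2 * q.+1 <= n -> can_force_component n q s.
Proof.
move=> n0 sq; exists greedy; first exact: greedy_valid.
move=> h ph h0; have := greedy_bound ph; rewrite h0 setD0.
set F := client_claimed h => bound.
have [v vs|small] := pickP (fun v => s <= #|component F v|); first by exists v.
(* The existence of one component makes the final inequality strict. *)
have c0 : 0 < #|components F|.
  by apply/card_gt0P; exists (component F (Ordinal n0)); apply: imset_f.
have c1 : q.+1 <= q.+1 * #|components F| by rewrite leq_pmulr.
have : n * (2 * q.+1) <= \sum_(v : 'I_n) (n - #|component F v|).
  rewrite -[X in X * _]card_ord -sum_nat_const; apply: leq_sum => v _.
  by have := small v; lia.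
have := disconnected_pairs F; lia.
Qed.

End Client.

Lemma le_CWcomp n q : n - 2 * q.+1 <= CWcomp n q.
Proof.
have [le|lt] := leqP n (2 * q.+1); first by rewrite (eqP (le : n - _ == 0)).
have n0 : 0 < n by lia.
by apply: (CWcomp_max q n0).2; apply: can_force_of_bias => //; lia.
Qed.

(** * Real-valued forms of the bounds *)

Local Open Scope ring_scope.

Lemma CWcomp_lt_of_powR (R : realType) (n k q : nat) : (0 < n)%N -> (0 < k)%N -> (0 < q)%N ->
  6 * n%:R `^ (2 ^+ k / (2 ^+ k - 1)) <= q%:R :> R -> (CWcomp n q < 3 ^ k)%N.
Proof.
case: k => // j n0 _ q0 hq.
have [m mE] : exists m, (2 ^ j.+1 = m.+2)%N.
  exists (2 ^ j.+1 - 2)%N; have : (2 ^ 1 <= 2 ^ j.+1)%N by rewrite leq_exp2l.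
  by lia.
have mR : 2 ^+ j.+1 = m.+2%:R :> R by rewrite -natrX mE.
have n1 : 1 <= n%:R :> R by rewrite ler1n.
have m1 : 2 ^+ j.+1 - 1 = m.+1%:R :> R by rewrite mR -natr1 addrK.
set a := 2 ^+ j.+1 / (2 ^+ j.+1 - 1) in hq.
have am : a * m.+1%:R = m.+2%:R by rewrite /a m1 mR divfK // pnatr_eq0.
have na : n%:R <= n%:R `^ a :> R.
  apply: le1r_powR => //; rewrite /a m1 mR ler_pdivlMr ?ltr0n // mul1r ler_nat.
  exact: leqnSn.
have nq : (6 * n <= q)%N by rewrite -(ler_nat R) natrM; lra.
(* The hypothesis raised to the power [m.+1 = 2 ^ k - 1]; multiplying by [6 * q] then gives the
   squaring condition. *)
have pw : (6 ^ m.+1 * n ^ m.+2 <= q ^ m.+1)%N.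
  rewrite -(ler_nat R) natrM !natrX.
  have -> : n%:R ^+ m.+2 = (n%:R `^ a) ^+ m.+1 :> R.
    by rewrite -[RHS]powR_mulrn ?powR_ge0 // -powRrM am powR_mulrn.
  by rewrite -exprMn lerXn2r ?nnegrE // mulr_ge0 ?powR_ge0.
apply: CWcomp_lt_of_squaring => //; rewrite mE expnMn (expnS 6) (expnS q m.+1).
have := leq_mul (leqnn (6 * q)%N) pw.
by move: (6 ^ m.+1)%N (n ^ m.+2)%N (q ^ m.+1)%N => x y z; lia.
Qed.

Lemma exists_double_log (n : nat) : (2 < n)%N ->
  exists2 i, (n <= 2 ^ (2 ^ i.+1))%N & (2 ^ (2 ^ i) < n)%N.
Proof.
move=> n2; set m := up_log 2 n.
have nm : (n <= 2 ^ m)%N by apply: up_logP.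
have m1 : (1 < m)%N.
  rewrite ltnNge; apply/negP => m1; have : (2 ^ m <= 2 ^ 1)%N by rewrite leq_exp2l.
  by lia.
have l0 : (0 < up_log 2 m)%N by rewrite up_log_gt0.
exists (up_log 2 m).-1; rewrite ?prednK //.
  by apply: leq_trans nm _; rewrite leq_exp2l // up_logP.
have := @up_log_gtn 2 n isT (ltnW n2); apply: leq_ltn_trans; rewrite leq_exp2l //.
by rewrite -ltnS prednK ?up_log_gtn // ltnW.
Qed.

Lemma CWcomp_lt_of_ln (R : realType) (eps : R) : 0 < eps ->
  exists n0 : nat, forall n q : nat, (n0 <= n)%N -> (0 < q)%N ->
    16 / 10 * n%:R <= q%:R :> R ->
    (CWcomp n q)%:R < ln (n%:R : R) `^ (ln 3 / ln 2 + eps).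
Proof.
move=> eps0; have [J [n1 H]] := CWcomp_lt_of_linear.
set a : R := ln 3 / ln 2.
have ln2 : 0 < ln 2 :> R by apply: ln_gt0; rewrite ltr1n.
have a0 : 0 < a by rewrite divr_gt0 // ln_gt0 // ltr1n.
(* [K] collects all constant factors of the bound [3 ^ (J + i.+2)]; for large [n] it is absorbed by
   the power [eps] of [ln n]. *)
pose K : R := 3 ^+ (J + 2) * (ln 2)^-1 `^ a.
have K0 : 0 <= K by rewrite mulr_ge0 ?exprn_ge0 ?powR_ge0.
have [n2 n2P] : exists n2 : nat, expR (K `^ eps^-1) <= n2%:R.
  by exists (Num.bound (expR (K `^ eps^-1))); apply/ltW/archi_boundP/expR_ge0.
exists (maxn 3 (maxn n1 n2)) => n q; rewrite !geq_max => /and3P[n3 nn1 nn2] q0 qn.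
have [i ni in_] := exists_double_log n3.
have C : (CWcomp n q < 3 ^ (J + i.+2))%N.
  apply: (H _ _ _ nn1 q0); first by rewrite -(ler_nat R) !natrM; lra.
  by rewrite (expnS 2 i.+1) (mulnC 2) expnM mulnn leq_exp2r.
have np : 0 < n%:R :> R by rewrite ltr0n; lia.
have lnn : K `^ eps^-1 <= ln n%:R.
  rewrite -ler_expR lnK ?posrE //; apply: le_trans n2P _; by rewrite ler_nat.
have ln0 : 0 < ln (n%:R : R) by apply: ln_gt0; rewrite ltr1n; lia.
have Kln : K <= ln n%:R `^ eps.
  have -> : K = (K `^ eps^-1) `^ eps by rewrite -powRrM mulVf ?lt0r_neq0 ?powRr1.
  by apply: ge0_ler_powR; rewrite ?nnegrE ?powR_ge0 // ltW.
have three : 3 ^+ i = (2 ^+ i) `^ a :> R.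
  rewrite -[RHS]lnK ?posrE ?powR_gt0 ?exprn_gt0 // ln_powR lnXn //.
  by rewrite mulrnAr divfK ?lt0r_neq0 // -lnXn // lnK // posrE exprn_gt0.
have pow2 : 2 ^+ i <= ln (n%:R : R) * (ln 2)^-1.
  rewrite ler_pdivlMr // -natrX mulr_natl -lnXn // -natrX ler_ln ?posrE ?ltr0n ?expn_gt0 //.
    by rewrite ler_nat ltnW.
  by lia.
rewrite powRD ?(lt0r_neq0 ln0) ?implybT //.
apply: lt_le_trans (_ : (3 ^ (J + i.+2))%:R <= _); first by rewrite ltr_nat.
rewrite natrX (_ : (J + i.+2 = i + (J + 2))%N); last by lia.
rewrite exprD three.
apply: le_trans (_ : (ln n%:R `^ a * (ln 2)^-1 `^ a) * 3 ^+ (J + 2) <= _).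
  rewrite ler_wpM2r ?exprn_ge0 // -powRM ?invr_ge0 ?(ltW ln0) ?(ltW ln2) //.
  by apply: (ge0_ler_powR (ltW a0)) => //; rewrite nnegrE ?divr_ge0
    ?(ltW ln0) ?(ltW ln2) ?exprn_ge0.
by rewrite -mulrA ler_wpM2l ?powR_ge0 // mulrC.
Qed.

(** With [t = eps^-1], the inverse of the left side is [e * exp(5/2 * (t - 1))]; since
    [1 + x <= exp x], this is at least [2 * t]. *)
Lemma expR_le_half (R : realType) (eps : R) : 0 < eps -> eps < 1 ->
  expR (- (5 / (2 * eps)) + 3 / 2) <= eps / 2.
Proof.
move=> e0 e1; set c := expR _.
have t1 : 1 < eps^-1 by rewrite invf_gt1.
have le : eps^-1 <= expR (5 / 2 * eps^-1 - 5 / 2).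
  by apply: le_trans (expR_ge1Dx _); lra.
have ce : c * expR 1 * expR (5 / 2 * eps^-1 - 5 / 2) = 1.
  rewrite /c -!expRD -[RHS]expR0; congr expR; field; exact: lt0r_neq0.
have c0 : 0 < c by apply: expR_gt0.
have two : 2 <= expR 1 :> R by apply: le_trans (expR_ge1Dx _); lra.
have : c * 2 * eps^-1 <= 1.
  by rewrite -[leRHS]ce; apply: ler_pM => //; rewrite ?ler_pM2l
    ?mulr_ge0 ?invr_ge0 ?(ltW c0) ?(ltW e0).
by rewrite ler_pdivrMr // mul1r; lra.
Qed.

Lemma CWcomp_ge_linear (R : realType) (eps : R) : 0 < eps -> eps < 1 ->
  exists n0 : nat, forall n q : nat, (n0 <= n)%N -> (0 < q)%N ->
    q%:R <= (1 - eps) * (n%:R / 2) ->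
    expR (- (5 / (2 * eps)) + 3 / 2) * n%:R <= (CWcomp n q)%:R.
Proof.
(* [le_CWcomp] gives [eps * n - 2], which is at least [eps * n / 2] once [eps * n >= 4]. *)
move=> e0 e1; exists (Num.bound (4 / eps)) => n q nn _ hq.
have n4 : 4 / eps <= n%:R.
  by apply: le_trans (ltW (archi_boundP _)) _; rewrite ?ler_nat // divr_ge0 // ltW.
rewrite ler_pdivrMr // in n4.
have := le_CWcomp n q; rewrite leq_subLR -(ler_nat R) natrD natrM -natr1 => hC.
have := ler_wpM2r (ler0n R n) (expR_le_half e0 e1).
by lra.
Qed.

Theorem theorem1p2 (R : realType) :
  [/\ forall n k q : nat, (0 < n)%N -> (0 < k)%N -> (0 < q)%N ->
        6 * n%:R `^ (2 ^+ k / (2 ^+ k - 1)) <= q%:R :> R ->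
        (CWcomp n q < 3 ^ k)%N,
      forall eps : R, 0 < eps ->
        exists n0 : nat, forall n q : nat, (n0 <= n)%N -> (0 < q)%N ->
          16 / 10 * n%:R <= q%:R :> R ->
          (CWcomp n q)%:R < ln (n%:R : R) `^ (ln 3 / ln 2 + eps)
    & forall eps : R, 0 < eps -> eps < 1 ->
        exists n0 : nat, forall n q : nat, (n0 <= n)%N -> (0 < q)%N ->
          q%:R <= (1 - eps) * (n%:R / 2) ->
          expR (- (5 / (2 * eps)) + 3 / 2) * n%:R <= (CWcomp n q)%:R].
Proof.
split; [exact: CWcomp_lt_of_powR|exact: CWcomp_lt_of_ln|exact: CWcomp_ge_linear].
Qed.
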